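(* For every $k>0$ the function $$F\mapsto e^{k\,\|\mathrm{dev}_3\log U\|^2},\qquad F\in\mathrm{GL}^+(3),\quad U=\sqrt{F^TF},$$ is not rank-one convex.
   Context: $\mathrm{GL}^+(3)=\{F\in\mathbb{R}^{3\times3}:\det F>0\}$; $\log U$ is the principal (symmetric) logarithm of the symmetric positive definite matrix $U$; $\|X\|^2=\mathrm{tr}(XX^T)$; $\mathrm{dev}_3X=X-\frac13\mathrm{tr}(X)I$. A function $W$ is rank-one convex on $\mathrm{GL}^+(3)$ if it is convex on every closed line segment contained in $\mathrm{GL}^+(3)$ whose end points differ by a matrix of rank one. *)

(* Defs.v *)
From HB Require Import structures.
From mathcomp Require Import all_boot all_order all_algebra.
From mathcomp Require Import all_classical all_reals all_analysis.

Set Implicit Arguments.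
Unset Strict Implicit.
Unset Printing Implicit Defensive.

Import Order.TTheory GRing.Theory Num.Theory.
Import numFieldNormedType.Exports.

Local Open Scope classical_set_scope.
Local Open Scope ring_scope.

Section MatrixFunctions.
Context {R : realType} {n : nat}.
Implicit Types A U L : 'M[R]_n.+1.

Definition posdefmx A : Prop :=
  A^T = A /\ forall x : 'cV[R]_n.+1, x != 0 -> 0 < (x^T *m A *m x) 0 0.

(* The matrix exponential of L is U: the partial sums of the exponential
   series of L converge to U. *)
Definition is_expmx L U : Prop :=
  series (fun m : nat => (m`!%:R)^-1 *: L ^+ m) @ \oo --> U.

(* The positive definite square root of a symmetric positive definite matrix;
   0 where there is none. *)
Definition sqrtmx A : 'M[R]_n.+1 :=
  xget 0 [set U | posdefmx U /\ U *m U = A].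

(* The principal logarithm of a symmetric positive definite matrix, i.e. its
   only symmetric logarithm; 0 where there is none. *)
Definition logmx U : 'M[R]_n.+1 :=
  xget 0 [set L | L^T = L /\ is_expmx L U].

Definition frob_sq A : R := \tr (A *m A^T).

End MatrixFunctions.

Section RankOneConvexity.
Context {R : realType}.

Definition GLplus3 : set 'M[R]_3 := [set F | 0 < \det F].

Definition dev3 (X : 'M[R]_3) : 'M[R]_3 := X - (3%:R^-1 * \tr X)%:M.

Definition line_segment (F G : 'M[R]_3) : set 'M[R]_3 :=
  [set (1 - t) *: F + t *: G | t in `[0, 1]].

(* W is a total function, but only its values on GLplus3 matter. *)
Definition rank_one_convex_GLplus3 (W : 'M[R]_3 -> R) : Prop :=
  forall F G : 'M[R]_3,
    \rank (G - F) = 1%N ->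
    line_segment F G `<=` GLplus3 ->
    @convex_function R 'M[R]_3 (line_segment F G) W.

Definition exp_dev_hencky (k : R) (F : 'M[R]_3) : R :=
  let U := sqrtmx (F^T *m F) in
  expR (k * frob_sq (dev3 (logmx U))).

End RankOneConvexity.

(* Main.v *)
Require Import Defs.
From mathcomp Require Import all_boot all_order all_algebra.
From mathcomp Require Import all_classical all_reals all_analysis.
From mathcomp Require Import ring lra.

(** Write [x_i] for the logarithms of the singular values of [F]. The energy is
    the exponential of [k] times [\sum_i (x_i - mean x) ^+ 2], and when
    [x = (m + d/2, m - d/2, z)] this sum is [d ^+ 2 / 2 + 2/3 * (m - z) ^+ 2]:
    the first term sees the distortion of a planar block, the second one the
    contrast between its area [expR (2 * m)] and the transverse stretch
    [expR z].

    The planar term is not convex along shears: the block [[1, s], [0, 1]] has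
    [d] close to [2 * ln s], and the square of a logarithm is concave for large
    [s]. For large [k] the exponential hides this wherever the exponent has a
    slope along the line, and the transverse term serves to remove the slope.
    Let the area [D] of the block [[1, s], [0, D]] decrease slightly and
    linearly in [s], and take [expR z] very small: then [2/3 * (m - z) ^+ 2]
    varies almost linearly, at a rate prescribed by [z]. The right rate
    balances the two ends of the segment, and the exponent at each end becomes
    smaller than the exponent at the midpoint. This comparison survives
    multiplication by any [k > 0] and exponentiation, so that midpoint
    convexity fails for all [k] on one and the same segment.

    Concretely the segment joins [(s, D) = (0, 11/10)] to [(60, 9/10)] through
    [(30, 1)]. With [l = ln 2], the values of [d] are at most [1/10] at the
    first end, at least [9 * l] at the midpoint and at most [12 * l] at the
    last end. As [81/2] exceeds half of [144/2], the choice
    [z = - 540 * l ^+ 2] works: it makes the transverse term contribute about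
    [+ 36 * l ^+ 2] and [- 36 * l ^+ 2] at the ends, against
    [d ^+ 2 / 2 >= 81/2 * l ^+ 2] in the middle
    ([sheared_stretch_energy], [rank_one_convex_midpoint]).

    The square root and the logarithm in the energy are characterized by
    equations, so their values require a uniqueness argument. At all three
    points the singular values are pairwise distinct; a square root or a
    logarithm of [U] commutes with [U], hence is then diagonal in the
    eigenbasis of [U], and its entries are given by the scalar functions
    ([sqrtmxE], [logmxE]). *)

Set Implicit Arguments.
Unset Strict Implicit.
Unset Printing Implicit Defensive.

Import Order.TTheory GRing.Theory Num.Theory.
Import numFieldNormedType.Exports.

Local Open Scope classical_set_scope.
Local Open Scope ring_scope.

(** * Square roots and logarithms with simple spectrum *)

Section DiagonalMatrices.
Context {R : realType} {n : nat}.
Implicit Types (A M L U Q : 'M[R]_n.+1) (a x : 'rV[R]_n.+1).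

(** Entrywise, commutation reads [(a_j - a_i) * M_ij = 0]. *)
Lemma comm_diag_mx_diag M a : injective (a 0) ->
  M *m diag_mx a = diag_mx a *m M -> exists d, M = diag_mx d.
Proof.
move=> a_inj Ma; apply/diag_mxP/is_diag_mxP => i j neq_ij.
have /matrixP/(_ i j) := Ma; rewrite mul_mx_diag mul_diag_mx !mxE mulrC.
move/eqP; rewrite -subr_eq0 -mulrBl mulf_eq0 => /orP[|/eqP//].
by rewrite subr_eq0 => /eqP/a_inj ji; rewrite ji eqxx in neq_ij.
Qed.

Lemma expr_diag_mx x m : diag_mx x ^+ m = diag_mx (\row_i (x 0 i) ^+ m).
Proof.
elim: m => [|m IHm].
  rewrite expr0 -[1]/(1%:M) -diag_const_mx; congr diag_mx; apply/rowP => i.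
  by rewrite !mxE expr0.
rewrite exprS IHm -mulmxE mulmx_diag; congr diag_mx; apply/rowP => i.
by rewrite !mxE exprS.
Qed.

Lemma cvg_mx_entrywise (u : nat -> 'M[R]_n.+1) L :
  (forall i j, u m i j @[m --> \oo] --> L i j) -> u @ \oo --> L.
Proof.
move=> uL B [P LP PB].
have : \forall m \near \oo, forall i j, P i j (u m i j).
  by apply: filter_forall => i; apply: filter_forall => j; exact/uL/LP.
by apply: filterS => m Pm; exact: PB.
Qed.

Lemma cvg_mx_coord (u : nat -> 'M[R]_n.+1) L :
  u @ \oo --> L -> forall i j, u m i j @[m --> \oo] --> L i j.
Proof.
move=> uL i j.
apply: (@continuous_cvg _ _ _ _ _ u (fun M : 'M[R]_n.+1 => M i j)) => //.
exact: coord_continuous. Qed.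

Arguments cvg_mx_coord [u L] _ i j _ _.

Lemma cvg_mulmx A M (u : nat -> 'M[R]_n.+1) L : u @ \oo --> L ->
  A *m u m *m M @[m --> \oo] --> A *m L *m M.
Proof.
move=> uL; apply: cvg_mx_entrywise => i j; rewrite mxE.
under eq_fun do rewrite mxE.
apply: (cvg_big add_continuous) => k _; apply: cvgMr_tmp; rewrite mxE.
under eq_fun do rewrite mxE.
apply: (cvg_big add_continuous) => l _; apply: cvgMl_tmp; exact: cvg_mx_coord.
Qed.

Lemma expmx_unique L U M : is_expmx L U -> is_expmx L M -> U = M.
Proof.
move=> LU LM; apply/matrixP => i j.
exact: (@cvg_unique R (@Rhausdorff R) _ _ _ _ (cvg_mx_coord LU i j)
                                              (cvg_mx_coord LM i j)).
Qed.

Lemma expmx_diag x : is_expmx (diag_mx x) (diag_mx (\row_i expR (x 0 i))).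
Proof.
apply: cvg_mx_entrywise => i j; rewrite !mxE.
have -> : (fun m => series (fun m => (m`!%:R)^-1 *: diag_mx x ^+ m) m i j)
    = (fun m => series (exp_coeff (x 0 i)) m *+ (i == j)).
  apply/funext => m; rewrite /series/= summxE -sumrMnl.
  apply: eq_bigr => k _; rewrite expr_diag_mx !mxE /exp_coeff /= mulrnAr.
  by rewrite [_^-1 * _]mulrC.
case: eqP => _; last by rewrite mulr0n; exact: cvg_cst.
exact: is_cvg_series_exp_coeff.
Qed.

Arguments expmx_diag x : clear implicits.

(** [L] commutes with the partial sums of its exponential series, hence with
    their limit. *)
Lemma expmx_comm L U : is_expmx L U -> L *m U = U *m L.
Proof.
rewrite /is_expmx => LU.
set u := series _ in LU *.
have Lu_uL : (fun m => L *m u m *m 1) = (fun m => 1 *m u m *m L).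
  apply/funext => m; rewrite mulmx1 mul1mx /u /series/= mulmx_sumr mulmx_suml.
  apply: eq_bigr => k _; rewrite -scalemxAl -scalemxAr; congr (_ *: _).
  by rewrite mulmxE -exprS exprSr.
have := cvg_mulmx (A := L) (M := 1) LU; rewrite Lu_uL mulmx1 => LU1.
have := cvg_mulmx (A := 1) (M := L) LU; rewrite mul1mx => LU2.
apply/matrixP => i j.
exact: (@cvg_unique R (@Rhausdorff R) _ _ _ _ (cvg_mx_coord LU1 i j)
                                              (cvg_mx_coord LU2 i j)).
Qed.

Lemma expmx_conj Q L U : Q *m Q^T = 1%:M ->
  is_expmx L U -> is_expmx (Q *m L *m Q^T) (Q *m U *m Q^T).
Proof.
move=> QQT; have QTQ := mulmx1C QQT => LU.
rewrite /is_expmx; set u := series _.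
suff -> : u = fun m => Q *m series (fun k => (k`!%:R)^-1 *: L ^+ k) m *m Q^T.
  exact: cvg_mulmx LU.
apply/funext => m.
rewrite /u /series /= mulmx_sumr mulmx_suml; apply: eq_bigr => k _.
rewrite -scalemxAr -scalemxAl; congr (_ *: _).
elim: k => [|k IHk]; first by rewrite !expr0 mulmx1 QQT.
by rewrite !exprS IHk -!mulmxE !mulmxA -(mulmxA (Q *m L)) QTQ mulmx1.
Qed.

(** In the eigenbasis of the exponential, [L] commutes with a diagonal matrix
    with distinct entries. So [L] is diagonal there, and its entries are found
    by injectivity of the scalar exponential. *)
Lemma logmx_unique Q x L : injective (x 0) -> Q *m Q^T = 1%:M ->
  is_expmx L (Q^T *m diag_mx (\row_i expR (x 0 i)) *m Q) ->
  L = Q^T *m diag_mx x *m Q.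
Proof.
move=> x_inj QQT /(expmx_conj QQT); have QTQ := mulmx1C QQT.
rewrite !mulmxA QQT mul1mx -(mulmxA _ Q) QQT mulmx1 => expM.
suff <- : Q *m L *m Q^T = diag_mx x.
  by rewrite !mulmxA QTQ mul1mx -mulmxA QTQ mulmx1.
have [] := comm_diag_mx_diag _ (expmx_comm expM).
  by move=> i j; rewrite !mxE => /expR_inj/x_inj.
move=> d dE; rewrite dE in expM *; congr diag_mx.
have /matrixP E := expmx_unique expM (expmx_diag d).
by apply/rowP => i; have := E i i; rewrite !mxE eqxx !mulr1n => /expR_inj ->.
Qed.

Lemma logmxE Q x : injective (x 0) -> Q *m Q^T = 1%:M ->
  logmx (Q^T *m diag_mx (\row_i expR (x 0 i)) *m Q) = Q^T *m diag_mx x *m Q.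
Proof.
move=> x_inj QQT; have QTQ := mulmx1C QQT.
apply: xget_unique => [|L [_ LU]]; last exact: logmx_unique LU.
split; first by rewrite !trmx_mul trmxK tr_diag_mx mulmxA.
have := @expmx_conj Q^T _ _ _ (expmx_diag x).
by rewrite trmxK; apply.
Qed.

Lemma posdefmx_diag Q a : (forall i, 0 < a 0 i) -> Q *m Q^T = 1%:M ->
  posdefmx (Q^T *m diag_mx a *m Q).
Proof.
move=> a_gt0 QQT; have QTQ := mulmx1C QQT; split.
  by rewrite !trmx_mul trmxK tr_diag_mx mulmxA.
move=> v v_neq0; set w := Q *m v.
have -> : v^T *m (Q^T *m diag_mx a *m Q) *m v = w^T *m diag_mx a *m w.
  by rewrite trmx_mul !mulmxA.
have w_neq0 : w != 0.
  apply: contraNneq v_neq0 => w0.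
  by rewrite -[v]mul1mx -QTQ -mulmxA -/w w0 mulmx0.
have -> : (w^T *m diag_mx a *m w) 0 0 = \sum_i a 0 i * w i 0 ^+ 2.
  rewrite mxE; apply: eq_bigr => i _.
  by rewrite mul_mx_diag mxE [w^T _ _]mxE; ring.
rewrite lt_def sumr_ge0 ?andbT; last first.
  by move=> i _; rewrite mulr_ge0 ?sqr_ge0 ?(ltW (a_gt0 i)).
apply: contraNneq w_neq0 => /psumr_eq0P w0.
apply/eqP/colP => i; rewrite [RHS]mxE.
have /eqP := w0 (fun j _ => mulr_ge0 (ltW (a_gt0 j)) (sqr_ge0 _)) i isT.
by rewrite mulf_eq0 gt_eqF ?a_gt0//= expf_eq0 /= => /eqP.
Qed.

(** A positive definite root commutes with its square, so it is diagonal in the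
    eigenbasis of the square; positivity of the quadratic form at the basis
    vectors then fixes the signs of its entries. *)
Lemma sqrtmxE Q a : (forall i, 0 < a 0 i) -> injective (a 0) ->
  Q *m Q^T = 1%:M ->
  sqrtmx (Q^T *m diag_mx (\row_i a 0 i ^+ 2) *m Q) = Q^T *m diag_mx a *m Q.
Proof.
move=> a_gt0 a_inj QQT; have QTQ := mulmx1C QQT.
have diag_sq d : diag_mx d *m diag_mx d = diag_mx (\row_i d 0 i ^+ 2) :> 'M[R]_n.+1.
  by rewrite mulmx_diag; congr diag_mx; apply/rowP => i; rewrite !mxE expr2.
apply: xget_unique => [|U [[_ U_pos] UU]].
  split; first exact: posdefmx_diag.
  by rewrite -diag_sq !mulmxA -(mulmxA (_ *m _) Q) QQT mulmx1.
suff <- : Q *m U *m Q^T = diag_mx a.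
  by rewrite !mulmxA QTQ mul1mx -mulmxA QTQ mulmx1.
set M := Q *m U *m Q^T.
have MM : M *m M = diag_mx (\row_i a 0 i ^+ 2).
  rewrite /M !mulmxA -(mulmxA (Q *m U) Q^T Q) QTQ mulmx1 -(mulmxA Q) UU.
  by rewrite !mulmxA QQT mul1mx -mulmxA QQT mulmx1.
have [] := @comm_diag_mx_diag M (\row_i a 0 i ^+ 2).
- move=> i j; rewrite !mxE => /eqP; rewrite eqrXn2 ?(ltW (a_gt0 _))// => /eqP.
  exact: a_inj.
- by rewrite -MM mulmxA.
move=> d Md; rewrite Md; congr diag_mx; apply/rowP => i.
have d_gt0 : 0 < d 0 i.
  have e_neq0 : Q^T *m delta_mx i 0 != 0 :> 'cV[R]_n.+1.
    apply/eqP => /(congr1 (mulmx Q)); rewrite mulmxA QQT mul1mx mulmx0.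
    by move=> /colP/(_ i)/eqP; rewrite !mxE !eqxx oner_eq0.
  have := U_pos _ e_neq0; rewrite trmx_mul trmxK trmx_delta !mulmxA.
  rewrite -(mulmxA _ U) -(mulmxA _ Q) (mulmxA Q) -/M Md.
  rewrite -rowE mxE (bigD1 i)//= big1 => [|j ji].
    by rewrite !mxE !eqxx mulr1 mulr1n addr0.
  by rewrite !mxE (negPf ji) mulr0.
have := MM; rewrite Md diag_sq => /matrixP/(_ i i).
rewrite !mxE eqxx !mulr1n => /eqP; rewrite eqrXn2 ?ltW//.
by move=> /eqP.
Qed.

End DiagonalMatrices.

(** * The energy of a sheared stretch *)

Section Energy.
Context {R : realType}.

Lemma frob_sq_dev3_conj (Q : 'M[R]_3) (x : 'rV[R]_3) : Q *m Q^T = 1%:M ->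
  frob_sq (dev3 (Q^T *m diag_mx x *m Q)) =
  \sum_i (x 0 i - 3^-1 * \sum_j x 0 j) ^+ 2.
Proof.
move=> QQT; have QTQ := mulmx1C QQT.
have trE y : \tr (Q^T *m diag_mx y *m Q) = \sum_i y 0 i.
  by rewrite mxtrace_mulC mulmxA QQT mul1mx mxtrace_diag.
rewrite /dev3 trE; set c := _ * _.
have -> : Q^T *m diag_mx x *m Q - c%:M = Q^T *m diag_mx (x - const_mx c) *m Q.
  rewrite raddfB /= diag_const_mx mulmxBr mulmxBl scalar_mxC -[c%:M *m _ *m _]mulmxA.
  by rewrite QTQ mulmx1.
rewrite /frob_sq !trmx_mul trmxK tr_diag_mx !mulmxA -(mulmxA _ Q) QQT mulmx1.
rewrite -(mulmxA _ (diag_mx _) (diag_mx _)) mulmx_diag trE.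
by apply: eq_bigr => i _; rewrite !mxE expr2.
Qed.

Lemma exp_dev_hencky_conj (k : R) (F Q : 'M[R]_3) (x : 'rV[R]_3) :
  injective (x 0) -> Q *m Q^T = 1%:M ->
  F^T *m F = Q^T *m diag_mx (\row_i expR (x 0 i) ^+ 2) *m Q ->
  exp_dev_hencky k F =
  expR (k * \sum_i (x 0 i - 3^-1 * \sum_j x 0 j) ^+ 2).
Proof.
move=> x_inj QQT FTF; rewrite /exp_dev_hencky FTF.
have -> : (\row_i expR (x 0 i) ^+ 2) =
    \row_i ((\row_j expR (x 0 j)) : 'rV[R]_3) 0 i ^+ 2.
  by apply/rowP => i; rewrite !mxE.
rewrite sqrtmxE //.
- by rewrite logmxE // frob_sq_dev3_conj.
- by move=> i; rewrite mxE expR_gt0.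
- by move=> i j; rewrite !mxE => /expR_inj/x_inj.
Qed.

Definition mx3 (rows : seq (seq R)) : 'M[R]_3 :=
  \matrix_(i, j) nth 0 (nth [::] rows i) j.

(** The planar block [[1, s], [0, D]] with the transverse stretch [w]; the
    family is affine in [(s, D)], and all differences at fixed [w] live in the
    second column, hence have rank at most one. *)
Definition sheared_stretch (s D w : R) : 'M[R]_3 :=
  mx3 [:: [:: 1; s; 0]; [:: 0; D; 0]; [:: 0; 0; w]].

(** The squared singular values of the block have product [D ^+ 2] and sum
    [1 + s ^+ 2 + D ^+ 2]; they are [expR (2 * m + d)] and [expR (2 * m - d)],
    and [z < m - d / 2] keeps the transverse one apart from both. *)
Lemma sheared_stretch_energy (k s D m d z : R) :
  0 <= s -> 0 < d -> z < m - d / 2 -> expR (2 * m) = D ->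
  D * (expR d + expR (- d)) = 1 + s ^+ 2 + D ^+ 2 ->
  exp_dev_hencky k (sheared_stretch s D (expR z)) =
  expR (k * (d ^+ 2 / 2 + 2 / 3 * (m - z) ^+ 2)).
Proof.
move=> s_ge0 d_gt0 z_lt ED; rewrite mulrDr -{1 2}ED -!expRD.
set l1 := expR (_ + d); set l2 := expR (_ - d) => l1l2D.
have l1l2M : l1 * l2 = D ^+ 2.
  by rewrite /l1 /l2 -ED -expRD expr2 -expRD; congr expR; ring.
have l21 : l2 < l1 by rewrite ltr_expR; lra.
have l21_gt0 : 0 < l1 - l2 by rewrite subr_gt0.
have s2E : s ^+ 2 = (l1 - 1) * (1 - l2) by nra.
have l1_ge1 : 1 <= l1 by nra.
have l2_le1 : l2 <= 1 by nra.
(* [(c, t)] is the unit eigenvector of [F^T F] for [l1]: its squared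
   coordinates solve [c^2 + t^2 = 1] and [l1 * c^2 + l2 * t^2 = 1], and both
   coordinates are nonnegative because [s] is. *)
pose c := Num.sqrt ((1 - l2) / (l1 - l2)).
pose t := Num.sqrt ((l1 - 1) / (l1 - l2)).
have l21_neq0 : l1 - l2 != 0 by rewrite gt_eqF.
have c2 : c ^+ 2 = (1 - l2) / (l1 - l2).
  by rewrite sqr_sqrtr// divr_ge0 ?subr_ge0 // ltW.
have t2 : t ^+ 2 = (l1 - 1) / (l1 - l2).
  by rewrite sqr_sqrtr// divr_ge0 ?subr_ge0 // ltW.
have ct : c * t = s / (l1 - l2).
  have s_div_ge0 : 0 <= s / (l1 - l2) by rewrite divr_ge0 // ltW.
  apply/eqP; rewrite -(@eqrXn2 _ 2) //; last by rewrite mulr_ge0 ?sqrtr_ge0.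
  by rewrite exprMn c2 t2 expr_div_n s2E; apply/eqP; field.
have cct : c ^+ 2 + t ^+ 2 = 1 by rewrite c2 t2; field.
pose Q := mx3 [:: [:: c; t; 0]; [:: - t; c; 0]; [:: 0; 0; 1]].
pose x : 'rV[R]_3 := \row_i nth 0 [:: m + d / 2; m - d / 2; z] i.
have x_inj : injective (x 0).
  move=> [[|[|[|//]]] ?] [[|[|[|//]]] ?]; rewrite !mxE /= => E;
    by [exact: val_inj | exfalso; lra].
have QQT : Q *m Q^T = 1%:M.
  apply/matrixP => -[[|[|[|//]]] ?] [[|[|[|//]]] ?];
  rewrite !mxE !big_ord_recl big_ord0 !mxE /=; lra.
have e1 : expR (m + d / 2) ^+ 2 = l1.
  by rewrite /l1 expr2 -expRD; congr expR; field.
have e2 : expR (m - d / 2) ^+ 2 = l2.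
  by rewrite /l2 expr2 -expRD; congr expR; field.
rewrite (@exp_dev_hencky_conj k (sheared_stretch s D (expR z)) Q x) //.
  congr (expR (k * _)); rewrite !big_ord_recl !big_ord0 !mxE /=; by field.
have C11 : c ^+ 2 * l1 + t ^+ 2 * l2 = 1 by rewrite c2 t2; field.
have C12 : c * t * (l1 - l2) = s by rewrite ct; field.
have C22 : t ^+ 2 * l1 + c ^+ 2 * l2 = s ^+ 2 + D ^+ 2.
  by rewrite -l1l2M s2E c2 t2; field.
rewrite mul_mx_diag; apply/matrixP => i j.
rewrite !mxE !big_ord_recl !big_ord0 !mxE /=.
case: i j => [[|[|[|//]]] ?] [[|[|[|//]]] ?] /=; rewrite ?e1 ?e2.
all: lra.
Qed.

(** Solves for the distortion [d] of a block with given invariants; [expR d] is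
    the larger root of [X^2 - h * X + 1]. *)
Lemma expRD_expRN_surj (h : R) : 2 < h ->
  exists2 d : R, 0 < d & expR d + expR (- d) = h.
Proof.
move=> h_gt2; pose q := Num.sqrt (h ^+ 2 - 4).
have q2 : q ^+ 2 = h ^+ 2 - 4 by rewrite sqr_sqrtr //; nra.
have q_ge0 : 0 <= q by exact: sqrtr_ge0.
have r_gt1 : 1 < (h + q) / 2 by lra.
have r_gt0 : 0 < (h + q) / 2 by lra.
exists (ln ((h + q) / 2)); first by rewrite ln_gt0.
rewrite expRN lnK // -[X in X + _]mulr1.
have r_neq0 : h + q != 0 by rewrite gt_eqF //; lra.
apply: (mulfI r_neq0).
have -> : ((h + q) / 2)^-1 = 2 / (h + q) by field.
have -> : (h + q) * ((h + q) / 2 * 1 + 2 / (h + q)) = (h + q) ^+ 2 / 2 + 2 by field.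
lra.
Qed.

End Energy.

(** * Rank-one segments of sheared stretches *)

Section Lines.
Context {R : realType}.
Implicit Types s D w t : R.

Lemma sheared_stretch_line s1 s2 D1 D2 w t :
  (1 - t) *: sheared_stretch s1 D1 w + t *: sheared_stretch s2 D2 w =
  sheared_stretch ((1 - t) * s1 + t * s2) ((1 - t) * D1 + t * D2) w.
Proof.
apply/matrixP => i j; rewrite !mxE.
by case: i j => [[|[|[|//]]] ?] [[|[|[|//]]] ?] /=; ring.
Qed.

Lemma det_sheared_stretch s D w : \det (sheared_stretch s D w) = D * w.
Proof.
rewrite -det_tr det_trig; last first.
  apply/is_trig_mxP => i j; rewrite !mxE.
  by case: i j => [[|[|[|//]]] ?] [[|[|[|//]]] ?].
by rewrite !big_ord_recl big_ord0 !mxE /=; ring.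
Qed.

Lemma rank_sheared_stretchB s1 s2 D1 D2 w : s1 != s2 ->
  \rank (sheared_stretch s2 D2 w - sheared_stretch s1 D1 w) = 1%N.
Proof.
move=> s12; apply/eqP; rewrite eqn_leq lt0n mxrank_eq0; apply/andP; split.
  have -> : sheared_stretch s2 D2 w - sheared_stretch s1 D1 w =
      (\col_i nth 0 [:: s2 - s1; D2 - D1; 0] i) *m delta_mx 0 1.
    apply/matrixP => i j; rewrite !mxE big_ord_recl big_ord0 !mxE.
    by case: i j => [[|[|[|//]]] ?] [[|[|[|//]]] ?] /=; ring.
  exact: mulmx_max_rank.
apply: contraNneq s12 => /matrixP/(_ 0 1); rewrite !mxE /= => /eqP.
by rewrite subr_eq0 eq_sym.
Qed.

Lemma rank_one_convex_midpoint (W : 'M[R]_3 -> R) s1 s2 D1 D2 w :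
  rank_one_convex_GLplus3 W -> s1 != s2 -> 0 < D1 -> 0 < D2 -> 0 < w ->
  W (sheared_stretch ((s1 + s2) / 2) ((D1 + D2) / 2) w) <=
  (W (sheared_stretch s1 D1 w) + W (sheared_stretch s2 D2 w)) / 2.
Proof.
move=> W_convex s12 D1_gt0 D2_gt0 w_gt0.
set F := sheared_stretch s1 D1 w; set G := sheared_stretch s2 D2 w.
have segF : F \in line_segment F G.
  rewrite inE; exists 0 => /=; first by rewrite in_itv/= lexx ler01.
  by rewrite subr0 scale1r scale0r addr0.
have segG : G \in line_segment F G.
  rewrite inE; exists 1 => /=; first by rewrite in_itv/= lexx ler01.
  by rewrite subrr scale1r scale0r add0r.
have segGL : line_segment F G `<=` GLplus3.
  move=> _ [t /= + <-]; rewrite in_itv /= => /andP[t_ge0 t_le1].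
  rewrite /GLplus3 /= sheared_stretch_line det_sheared_stretch pmulr_lgt0 //.
  by nra.
have half_ge0 : 0 <= 2^-1 :> R by lra.
have half_le1 : 2^-1 <= 1 :> R by lra.
have : W (2^-1 *: F + (1 - 2^-1) *: G) <= 2^-1 * W F + (1 - 2^-1) * W G.
  exact: (W_convex F G (rank_sheared_stretchB _ _ _ s12) segGL
    (Itv01 half_ge0 half_le1) F G segF segG).
have halfE : 1 - 2^-1 = 2^-1 :> R by field.
have -> : 2^-1 *: F + (1 - 2^-1) *: G = (1 - 2^-1) *: F + 2^-1 *: G.
  by rewrite halfE.
by rewrite sheared_stretch_line halfE !(mulrC 2^-1) -!mulrDl.
Qed.

End Lines.

(** * Failure of convexity *)

Theorem lemma6p2 (R : realType) (k : R) (k_gt0 : 0 < k) :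
  ~ rank_one_convex_GLplus3 (exp_dev_hencky k).
Proof.
move=> W_convex.
set l : R := ln 2.
have expl j : expR (j%:R * l) = 2 ^+ j by rewrite expRM_natl lnK // posrE.
have l_ge : 2^-1 <= l.
  have := @expR_ge1Dx R (- l); rewrite expRN lnK ?posrE //; lra.
have l_sq : l <= 2 * l ^+ 2 by nra.
(* Makes [2/3 * (- z) * (1/10)], the shift of the transverse term at each
   end, equal to [36 * l ^+ 2]. *)
pose z : R := - (540 * l ^+ 2).
pose p : R := ln (11 / 10).
pose q : R := ln (9 / 10).
have Ep : expR p = 11 / 10 by rewrite lnK // posrE; lra.
have Eq : expR q = 9 / 10 by rewrite lnK // posrE; lra.
have p_gt0 : 0 < p by rewrite ln_gt0; lra.
have p_le : p <= 10^-1 by have := @expR_ge1Dx R p; lra.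
have q_le : q <= - 10^-1 by have := @expR_ge1Dx R q; lra.
have q_ge : - (9^-1) <= q.
  have := @expR_ge1Dx R (- q); rewrite expRN Eq invf_div; lra.
(* [512 <= 901 <= expR d0 <= 902 <= 1024] and [expR d1 <= 4096]. *)
have [d0 d0_gt0 Ed0] : exists2 d : R, 0 < d & expR d + expR (- d) = 2 + 30 ^+ 2.
  by apply: expRD_expRN_surj; lra.
have [d1 d1_gt0 Ed1] : exists2 d : R, 0 < d & expR d + expR (- d) =
    (1 + 60 ^+ 2 + (9 / 10) ^+ 2) / (9 / 10).
  by apply: expRD_expRN_surj; lra.
have d0_ge : 9 * l <= d0.
  rewrite -ler_expR expl; have : expR (- d0) <= 1 by rewrite -expR0 ler_expR; lra.
  lra.
have d0_le : d0 <= 10 * l.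
  rewrite -ler_expR expl; have := expR_gt0 (- d0); lra.
have d1_le : d1 <= 12 * l.
  rewrite -ler_expR expl; have := expR_gt0 (- d1); lra.
have d0_sq : 81 * l ^+ 2 <= d0 ^+ 2.
  have -> : 81 * l ^+ 2 = (9 * l) ^+ 2 by ring.
  by rewrite ler_sqr ?nnegrE //; lra.
have d1_sq : d1 ^+ 2 <= 144 * l ^+ 2.
  have -> : 144 * l ^+ 2 = (12 * l) ^+ 2 by ring.
  by rewrite ler_sqr ?nnegrE //; lra.
have p_sq : p ^+ 2 <= 100^-1 by nra.
have q_sq : q ^+ 2 <= 81^-1 by nra.
have pl : p * l ^+ 2 <= 10^-1 * l ^+ 2 by rewrite ler_wpM2r ?sqr_ge0.
have ql : q * l ^+ 2 <= - 10^-1 * l ^+ 2 by rewrite ler_wpM2r ?sqr_ge0.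
have z_ltF : z < p / 2 - p / 2 by rewrite /z; lra.
have z_ltM : z < 0 - d0 / 2 by rewrite /z; lra.
have z_ltG : z < q / 2 - d1 / 2 by rewrite /z; lra.
have EFM : p ^+ 2 / 2 + 2 / 3 * (p / 2 - z) ^+ 2 <
    d0 ^+ 2 / 2 + 2 / 3 * (0 - z) ^+ 2 by rewrite /z; lra.
have EGM : d1 ^+ 2 / 2 + 2 / 3 * (q / 2 - z) ^+ 2 <
    d0 ^+ 2 / 2 + 2 / 3 * (0 - z) ^+ 2 by rewrite /z; lra.
have z_gt0 := expR_gt0 z.
have double_half (y : R) : 2 * (y / 2) = y by field.
have := rank_one_convex_midpoint (s1 := 0) (s2 := 60) (D1 := 11 / 10)
  (D2 := 9 / 10) W_convex _ _ _ z_gt0.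
have -> : (0 + 60) / 2 = 30 :> R by field.
have -> : (11 / 10 + 9 / 10) / 2 = 1 :> R by field.
rewrite (@sheared_stretch_energy R k 0 (11 / 10) (p / 2) p z) ?double_half //;
  last by rewrite expRN Ep; field.
rewrite (@sheared_stretch_energy R k 30 1 0 d0 z) ?mulr0 ?expR0 //;
  last by rewrite Ed0; ring.
rewrite (@sheared_stretch_energy R k 60 (9 / 10) (q / 2) d1 z) ?double_half //;
  last by rewrite Ed1 mulrC divfK // gt_eqF // divr_gt0.
have s12 : 0 != 60 :> R by rewrite eq_sym pnatr_eq0.
move=> /(_ s12 (divr_gt0 (ltr0Sn _ _) (ltr0Sn _ _))
             (divr_gt0 (ltr0Sn _ _) (ltr0Sn _ _))).
apply/negP; rewrite -ltNge ltr_pdivrMr // mulr_natr mulr2n.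
by rewrite ltrD // ltr_expR ltr_pM2l.
Qed.
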